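(* Let $(D,\dashv,\vdash)$ be a diassociative algebra, $(B,\diamond,\varpi)$ a quadratic Zinbiel algebra, and $(D\otimes B,\cdot)$ the induced associative algebra, $(d_1\otimes b_1)\cdot(d_2\otimes b_2)=(d_1\vdash d_2)\otimes(b_1\diamond b_2)+(d_1\dashv d_2)\otimes(b_2\diamond b_1)$. Let $\{e_j\}$ be a basis of $B$, $\{f_j\}$ its dual basis ($\varpi(f_i,e_j)=\delta_{ij}$), and $\kappa=\sum_je_j\otimes f_j\in B\otimes B$. Let $r=\sum_ix_i\otimes y_i$ be a symmetric solution of the diassociative Yang-Baxter equation in $(D,\dashv,\vdash)$ and $\widetilde r=\sum_{i,j}(x_i\otimes e_j)\otimes(y_i\otimes f_j)$. Then the square relating $r$, $r^\sharp$, $\widetilde r$ and $\widetilde r^\sharp$ commutes: $r^\sharp:D^*\to D$ is an $\mathcal O$-operator of $(D,\dashv,\vdash)$ associated to the coregular bimodule $(D^*,\mathbf r_\vdash^*-\mathbf r_\dashv^*,-\mathbf l_\vdash^*,-\mathbf r_\dashv^*,\mathbf l_\dashv^*-\mathbf l_\vdash^* )$, $\widetilde r$ is a skew-symmetric solution of the associative Yang-Baxter equation in $(D\otimes B,\cdot)$, and $$\widetilde r^\sharp=r^\sharp\otimes\kappa^\sharp:(D\otimes B)^*=D^*\otimes B^*\to D\otimes B$$ is an $\mathcal O$-operator of $(D\otimes B,\cdot)$ associated to the coregular bimodule $((D\otimes B)^*,-\mathbf r_{D\otimes B}^*,-\mathbf l_{D\otimes B}^* )$.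
   Context: All vector spaces are finite-dimensional over a field $\Bbbk$ of characteristic zero; $\tau(x\otimes y)=y\otimes x$. For $\mu:A\to\mathrm{End}(V)$, $\mu^*:A\to\mathrm{End}(V^* )$ is $\langle\mu^*(a)(\xi),v\rangle=-\langle\xi,\mu(a)(v)\rangle$. For $s\in A\otimes A$, $s^\sharp:A^*\to A$ is $\langle\xi_2,s^\sharp(\xi_1)\rangle=\langle\xi_1\otimes\xi_2,s\rangle$. A diassociative algebra $(D,\dashv,\vdash)$ is a vector space with two associative products satisfying $(d_1\dashv d_2)\dashv d_3=d_1\dashv(d_2\vdash d_3)$, $(d_1\vdash d_2)\dashv d_3=d_1\vdash(d_2\dashv d_3)$, $(d_1\dashv d_2)\vdash d_3=(d_1\vdash d_2)\vdash d_3$; $\mathbf l_\dashv(d)(x)=d\dashv x$, $\mathbf r_\dashv(d)(x)=x\dashv d$, $\mathbf l_\vdash(d)(x)=d\vdash x$, $\mathbf r_\vdash(d)(x)=x\vdash d$. The diassociative Yang-Baxter equation for $r=\sum_ix_i\otimes y_i$ is $\sum_{i,j}\big(x_i\otimes x_j\otimes(y_i\vdash y_j)-x_j\otimes(x_i\dashv y_j)\otimes y_i-(x_i\vdash x_j)\otimes y_i\otimes y_j+(x_i\dashv x_j)\otimes y_i\otimes y_j\big)=0$; symmetric means $\tau(r)=r$. An $\mathcal O$-operator of $(D,\dashv,\vdash)$ associated to a bimodule $(V,\mathfrak l_\dashv,\mathfrak r_\dashv,\mathfrak l_\vdash,\mathfrak r_\vdash)$ (four linear maps $D\to\mathrm{End}(V)$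 giving the left/right actions for $\dashv$ and $\vdash$) is a linear map $T:V\to D$ with $T(v_1)\dashv T(v_2)=T(\mathfrak l_\dashv(T(v_1))v_2+\mathfrak r_\dashv(T(v_2))v_1)$ and $T(v_1)\vdash T(v_2)=T(\mathfrak l_\vdash(T(v_1))v_2+\mathfrak r_\vdash(T(v_2))v_1)$. A Zinbiel algebra satisfies $b_1\diamond(b_2\diamond b_3)=(b_1\diamond b_2)\diamond b_3+(b_2\diamond b_1)\diamond b_3$; quadratic: with a nondegenerate skew-symmetric form $\varpi$, $\varpi(b_1\diamond b_2,b_3)=\varpi(b_2,b_1\diamond b_3+b_3\diamond b_1)$. For an associative algebra $(A,\cdot)$, $\mathbf l_A(a)(x)=a\cdot x$, $\mathbf r_A(a)(x)=x\cdot a$; the associative Yang-Baxter equation for $s=\sum u_i\otimes v_i$ is $\sum_{i,j}\big((u_i\cdot u_j)\otimes v_i\otimes v_j+u_i\otimes u_j\otimes(v_i\cdot v_j)-u_j\otimes(u_i\cdot v_j)\otimes v_i\big)=0$; skew-symmetric means $\tau(s)=-s$. An $\mathcal O$-operator of $(A,\cdot)$ associated to a bimodule $(V,\mathfrak l,\mathfrak r)$ is a linear $T:V\to A$ with $T(v_1)\cdot T(v_2)=T(\mathfrak l(T(v_1))v_2+\mathfrak r(T(v_2))v_1)$. *)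

(* Defs.v *)
From HB Require Import structures.
From mathcomp Require Import all_boot all_order all_algebra.
Set Implicit Arguments.
Unset Strict Implicit.
Unset Printing Implicit Defensive.
Import GRing.Theory.
Local Open Scope ring_scope.

Section Linear.
Variable K : fieldType.
Implicit Types A U V W : vectType K.

Definition is_bilinear U V W (f : U -> V -> W) : Prop :=
  (forall v, linear (f^~ v)) /\ (forall u, linear (f u)).

(* Bilinear maps U x V -> W are the elements of 'Hom(U, 'Hom(V, W)); [linfun]
   is total, and [bilfun f] agrees with f as soon as f is bilinear. *)
Definition bilfun U V W (f : U -> V -> W) : 'Hom(U, 'Hom(V, W)) :=
  linfun (fun u => linfun (f u)).

Definition bilflip U V W (f : 'Hom(U, 'Hom(V, W))) : 'Hom(V, 'Hom(U, W)) :=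
  bilfun (fun v u => f u v).

Lemma linfun_linE U V (f : U -> V) : linear f -> forall u, linfun f u = f u.
Proof.
move=> lf u.
pose F : {linear U -> V} := HB.pack f (GRing.isLinear.Build _ _ _ _ f lf).
exact: (lfunE F u).
Qed.

Lemma bilfunE U V W (f : U -> V -> W) :
  is_bilinear f -> forall u v, bilfun f u v = f u v.
Proof.
move=> [lf1 lf2] u v; rewrite /bilfun linfun_linE ?linfun_linE//.
move=> a u1 u2; apply/lfunP => w.
by rewrite add_lfunE scale_lfunE !linfun_linE// lf1.
Qed.

Lemma bilfun_bilinear U V W (f : 'Hom(U, 'Hom(V, W))) :
  is_bilinear (fun u v => f u v).
Proof.
split=> [v a x y|u a x y]; last by rewrite linearP.
by rewrite linearP add_lfunE scale_lfunE.
Qed.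

Lemma bilflipE U V W (f : 'Hom(U, 'Hom(V, W))) u v : bilflip f v u = f u v.
Proof. by rewrite bilfunE//; case: (bilfun_bilinear f). Qed.

(* An element of the tensor product is its matrix of coordinates with respect
   to the library's chosen bases of U and V; [tlift_tens] and [tensor_ext] below
   are the universal property. *)
Definition tensor U V : vectType K := 'M[K]_(\dim {:U}, \dim {:V}).

Definition vbase U (i : 'I_(\dim {:U})) : U := (vbasis {:U})`_i.
Definition vcoord U (u : U) (i : 'I_(\dim {:U})) : K := coord (vbasis {:U}) i u.

Definition tens U V (u : U) (v : V) : tensor U V :=
  \matrix_(i, j) (vcoord u i * vcoord v j).

Definition tlift U V W (f : U -> V -> W) (t : tensor U V) : W :=
  \sum_i \sum_j t i j *: f (vbase i) (vbase j).

Lemma vbase_sum U (u : U) : u = \sum_i vcoord u i *: vbase i.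
Proof. exact/coord_vbasis/memvf. Qed.

Lemma vcoord_vbase U (i j : 'I_(\dim {:U})) : vcoord (vbase i) j = (i == j)%:R.
Proof.
by rewrite /vcoord /vbase coord_free // (basis_free (vbasisP _)).
Qed.

Lemma vcoord_linear U i : linear (fun u : U => vcoord u i : K^o).
Proof. by move=> a x y; rewrite /vcoord linearP. Qed.

Lemma tensE U V (u : U) (v : V) i j : tens u v i j = vcoord u i * vcoord v j.
Proof. by rewrite mxE. Qed.

Lemma tens_bilinear U V : is_bilinear (@tens U V).
Proof.
split=> [v|u] a x y; apply/matrixP => i j; rewrite !mxE vcoord_linear.
  by rewrite mulrDl mulrA.
by rewrite mulrDr mulrCA.
Qed.

Lemma tlift_linear U V W (f : U -> V -> W) : linear (tlift f).
Proof.
move=> a s t; rewrite /tlift scaler_sumr -big_split /=.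
apply: eq_bigr => i _; rewrite scaler_sumr -big_split /=.
by apply: eq_bigr => j _; rewrite !mxE scalerDl scalerA.
Qed.

Lemma linear_sum1E U W (f : U -> W) : linear f ->
  forall I (r : seq I) (u : I -> U),
    f (\sum_(i <- r) u i) = \sum_(i <- r) f (u i).
Proof.
move=> lf I r u; transitivity (linfun f (\sum_(i <- r) u i)).
  by rewrite linfun_linE.
by rewrite linear_sum; apply: eq_bigr => i _; rewrite /= linfun_linE.
Qed.

Lemma linear_sumE U W (f : U -> W) : linear f ->
  forall I (r : seq I) (c : I -> K) (u : I -> U),
    f (\sum_(i <- r) c i *: u i) = \sum_(i <- r) c i *: f (u i).
Proof.
move=> lf I r c u; rewrite linear_sum1E //; apply: eq_bigr => i _.
by rewrite -[LHS](linfun_linE lf) linearZ /= linfun_linE.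
Qed.

Lemma tlift_tens U V W (f : U -> V -> W) :
  is_bilinear f -> forall u v, tlift f (tens u v) = f u v.
Proof.
move=> [lf1 lf2] u v.
rewrite {2}(vbase_sum u) (linear_sumE (lf1 v)) /tlift.
apply: eq_bigr => i _; rewrite {2}(vbase_sum v) (linear_sumE (lf2 _)).
by rewrite scaler_sumr; apply: eq_bigr => j _; rewrite tensE scalerA.
Qed.

Lemma tensor_sum U V (t : tensor U V) :
  t = \sum_i \sum_j t i j *: tens (vbase i) (vbase j).
Proof.
rewrite [LHS]matrix_sum_delta; apply: eq_bigr => i _; apply: eq_bigr => j _.
congr (_ *: _); apply/matrixP => k l; rewrite tensE !vcoord_vbase !mxE.
by rewrite -natrM mulnb ![_ == i]eq_sym ![_ == j]eq_sym.
Qed.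

Lemma tensor_ext U V W (f g : tensor U V -> W) : linear f -> linear g ->
  (forall u v, f (tens u v) = g (tens u v)) -> f =1 g.
Proof.
move=> lf lg fg t; rewrite (tensor_sum t) (linear_sum1E lf) (linear_sum1E lg).
apply: eq_bigr => i _; rewrite (linear_sumE lf) (linear_sumE lg).
by apply: eq_bigr => j _; rewrite fg.
Qed.

Lemma tlift_fun_linear U V (X : vectType K) W (f : X -> U -> V -> W) (t : tensor U V) :
  (forall u v, linear (fun x => f x u v)) -> linear (fun x => tlift (f x) t).
Proof.
move=> lf a x y; rewrite /tlift scaler_sumr -big_split /=.
apply: eq_bigr => i _; rewrite scaler_sumr -big_split /=.
by apply: eq_bigr => j _; rewrite lf scalerDr !scalerA mulrC.
Qed.

(* [tlift2 f s t] is the sum of the f u_i v_i u'_j v'_j when s and t are the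
   sums of the u_i (x) v_i and of the u'_j (x) v'_j: see [tlift2_sum]. *)
Definition tlift2 U V (U' V' : vectType K) W (f : U -> V -> U' -> V' -> W)
    (s : tensor U V) (t : tensor U' V') : W :=
  tlift (fun u v => tlift (f u v) t) s.

Definition is_quadrilinear U V (U' V' : vectType K) W
    (f : U -> V -> U' -> V' -> W) : Prop :=
  (forall u v, is_bilinear (f u v)) /\
  (forall u' v', is_bilinear (fun u v => f u v u' v')).

Lemma tlift2_bilinear U V (U' V' : vectType K) W (f : U -> V -> U' -> V' -> W) :
  is_bilinear (tlift2 f).
Proof.
split=> [t|s]; first exact: tlift_linear.
by apply: tlift_fun_linear => u v; exact: tlift_linear.
Qed.

Lemma tlift2_tens U V (U' V' : vectType K) W (f : U -> V -> U' -> V' -> W) :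
  is_quadrilinear f ->
  forall u v u' v', tlift2 f (tens u v) (tens u' v') = f u v u' v'.
Proof.
move=> [qf1 qf2] u v u' v'; rewrite /tlift2 tlift_tens ?tlift_tens//.
by split=> [w|w]; apply: tlift_fun_linear => x y; case: (qf2 x y).
Qed.

Lemma tlift2_sum U V (U' V' : vectType K) W (f : U -> V -> U' -> V' -> W) :
  is_quadrilinear f ->
  forall I J (r : seq I) (q : seq J) (u : I -> U) (v : I -> V)
         (u' : J -> U') (v' : J -> V'),
    tlift2 f (\sum_(i <- r) tens (u i) (v i)) (\sum_(j <- q) tens (u' j) (v' j))
    = \sum_(i <- r) \sum_(j <- q) f (u i) (v i) (u' j) (v' j).
Proof.
move=> qf I J r q u v u' v'; have [b1 b2] := tlift2_bilinear f.
rewrite (linear_sum1E (b1 _)); apply: eq_bigr => i _.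
by rewrite (linear_sum1E (b2 _)); apply: eq_bigr => j _; rewrite tlift2_tens.
Qed.

Lemma tensPl U V (v : V) a (x y : U) :
  tens (a *: x + y) v = a *: tens x v + tens y v.
Proof. by case: (tens_bilinear U V) => + _; apply. Qed.

Lemma tensPr U V (u : U) a (x y : V) :
  tens u (a *: x + y) = a *: tens u x + tens u y.
Proof. by case: (tens_bilinear U V) => _; apply. Qed.

Lemma tensDr U V (u : U) (x y : V) : tens u (x + y) = tens u x + tens u y.
Proof. by rewrite -[x]scale1r tensPr !scale1r. Qed.

Lemma is_bilinearD U V W (f g : U -> V -> W) :
  is_bilinear f -> is_bilinear g -> is_bilinear (fun u v => f u v + g u v).
Proof.
by move=> [f1 f2] [g1 g2]; split=> [v|u] a x y;
  rewrite ?f1 ?g1 ?f2 ?g2 scalerDr addrACA.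
Qed.

Lemma is_bilinearN U V W (f : U -> V -> W) :
  is_bilinear f -> is_bilinear (fun u v => - f u v).
Proof.
by move=> [f1 f2]; split=> [v|u] a x y; rewrite ?f1 ?f2 scalerN opprD.
Qed.

Definition tswap U V (t : tensor U V) : tensor V U :=
  tlift (fun u v => tens v u) t.

Definition tensor_hom U V U' V' (f : 'Hom(U, U')) (g : 'Hom(V, V')) :
    'Hom(tensor U V, tensor U' V') :=
  linfun (tlift (fun u v => tens (f u) (g v))).

Definition dual V : vectType K := 'Hom(V, K^o).

(* The identification of V^* (x) W^* with (V (x) W)^*, which is bijective by
   [dual_tensor_bij]: <xi (x) eta, v (x) w> = <xi, v> <eta, w>. *)
Definition dual_tensor V W : 'Hom(tensor (dual V) (dual W), dual (tensor V W)) :=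
  linfun (tlift (fun (xi : dual V) (eta : dual W) =>
    linfun (tlift (fun v w => xi v * eta w : K^o)) : dual (tensor V W))).

Definition dual_rep A V (mu : 'Hom(A, 'End(V))) : 'Hom(A, 'End(dual V)) :=
  bilfun (fun (a : A) (xi : dual V) => - (xi \o mu a)%VF).

(* s^#, characterized by [sharpP]. *)
Definition sharp A (s : tensor A A) : 'Hom(dual A, A) :=
  linfun (fun xi : dual A => tlift (fun x y => (xi x : K) *: y) s).

Lemma tswap_tens U V (u : U) (v : V) : tswap (tens u v) = tens v u.
Proof.
rewrite /tswap tlift_tens //; split=> [w|w] a x y; first exact: tensPr.
exact: tensPl.
Qed.

Lemma tensor_homE U V U' V' (f : 'Hom(U, U')) (g : 'Hom(V, V')) u v :
  tensor_hom f g (tens u v) = tens (f u) (g v).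
Proof.
have [t1 t2] := tens_bilinear U' V'.
rewrite /tensor_hom linfun_linE ?tlift_tens//; last exact: tlift_linear.
by split=> [v'|u'] a x y; rewrite linearP ?t1 ?t2.
Qed.

Lemma pairing_bilinear V W (xi : dual V) (eta : dual W) :
  is_bilinear (fun v w => xi v * eta w : K^o).
Proof.
split=> [w|v] a x y; rewrite linearP.
  by rewrite mulrDl /GRing.scale /= mulrA.
by rewrite mulrDr /GRing.scale /= mulrCA.
Qed.

Lemma dual_tensorE V W (xi : dual V) (eta : dual W) t :
  dual_tensor V W (tens xi eta) t = tlift (fun v w => xi v * eta w : K^o) t.
Proof.
rewrite /dual_tensor linfun_linE ?tlift_tens ?linfun_linE//;
  try exact: tlift_linear.
split=> [w|v] a x y; apply/lfunP => s; rewrite add_lfunE scale_lfunE;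
  rewrite !linfun_linE; try exact: tlift_linear;
  rewrite /tlift scaler_sumr -big_split /=; apply: eq_bigr => i _;
  rewrite scaler_sumr -big_split /=; apply: eq_bigr => j _;
  rewrite add_lfunE scale_lfunE [a *: (s i j *: _)]scalerA [a * _]mulrC;
  rewrite -scalerA -scalerDr;
  congr (_ *: _); rewrite /GRing.scale /=.
  by rewrite mulrDl mulrA.
by rewrite mulrDr mulrCA.
Qed.

Lemma dual_tensor_tens V W (xi : dual V) (eta : dual W) v w :
  dual_tensor V W (tens xi eta) (tens v w) = xi v * eta w.
Proof. by rewrite dual_tensorE tlift_tens//; exact: pairing_bilinear. Qed.

Lemma dual_repE A V (mu : 'Hom(A, 'End(V))) a (xi : dual V) v :
  dual_rep mu a xi v = - xi (mu a v).
Proof.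
rewrite /dual_rep bilfunE ?opp_lfunE ?comp_lfunE//.
split=> [w|b] c x y; apply/lfunP => z;
  rewrite ?(opp_lfunE, add_lfunE, scale_lfunE, comp_lfunE).
  by rewrite linearP add_lfunE scale_lfunE linearP opprD scalerN.
by rewrite opprD scalerN.
Qed.

Lemma sharp_linear A (s : tensor A A) :
  linear (fun xi : dual A => tlift (fun x y => (xi x : K) *: y) s).
Proof.
move=> a x y; rewrite /tlift scaler_sumr -big_split /=.
apply: eq_bigr => i _; rewrite scaler_sumr -big_split /=.
apply: eq_bigr => j _; rewrite add_lfunE scale_lfunE.
rewrite scalerDl scalerDr; congr (_ + _).
rewrite -[a *: x _]/(a * x _) !scalerA; congr (_ *: _).
by rewrite mulrCA mulrA.
Qed.

Lemma sharp_tens A n (x y : 'I_n -> A) xi :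
  sharp (\sum_i tens (x i) (y i)) xi = \sum_i (xi (x i) : K) *: y i.
Proof.
rewrite /sharp (linfun_linE (@sharp_linear A _)).
rewrite (linear_sum1E (@tlift_linear _ _ _ _)); apply: eq_bigr => i _.
rewrite tlift_tens//; split=> [w|v] a p q.
  by rewrite linearP scalerDl scalerA.
by rewrite scalerDr !scalerA mulrC.
Qed.

Lemma sharpP A (s : tensor A A) (xi1 xi2 : dual A) :
  xi2 (sharp s xi1) = dual_tensor A A (tens xi1 xi2) s.
Proof.
rewrite /sharp (linfun_linE (@sharp_linear A _)) dual_tensorE /tlift.
rewrite linear_sum; apply: eq_bigr => i _; rewrite linear_sum.
by apply: eq_bigr => j _; do 2 rewrite linearZ /=.
Qed.

Lemma dual_tensor_bij V W : bijective (dual_tensor V W).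
Proof.
have bc U i : {c : dual U | forall u, c u = vcoord u i}.
  exists (linfun (fun u => vcoord u i : K^o)) => u.
  by rewrite (linfun_linE (vcoord_linear i)).
pose c U i : dual U := sval (bc U i).
have cE U i u : c U i u = vcoord u i by rewrite /c; case: (bc U i).
have dE U (xi : dual U) : xi = \sum_i (xi (vbase i) : K) *: c U i.
  apply/lfunP => u; rewrite sum_lfunE [in LHS](vbase_sum u) linear_sum.
  apply: eq_bigr => i _; rewrite linearZ scale_lfunE cE /GRing.scale /=.
  by rewrite mulrC.
pose g (phi : dual (tensor V W)) : tensor (dual V) (dual W) :=
  \sum_i \sum_j (phi (tens (vbase i) (vbase j)) : K) *: tens (c V i) (c W j).
exists g => [|phi]; last first.
  apply/lfunP; apply: (tensor_ext (linearP _) (linearP _)) => v w.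
  rewrite /= /g linear_sum /= sum_lfunE.
  have [t1 t2] := tens_bilinear V W.
  rewrite [in RHS](vbase_sum v) (linear_sumE (t1 w)) linear_sum.
  apply: eq_bigr => i _; rewrite linear_sum sum_lfunE linearZ /=.
  rewrite [in RHS](vbase_sum w) (linear_sumE (t2 _)) linear_sum scaler_sumr.
  apply: eq_bigr => j _; rewrite !linearZ scale_lfunE dual_tensor_tens !cE.
  rewrite -[RHS]/(vcoord w j * (vcoord v i * phi _)) [LHS]mulrA [LHS]mulrC.
  by rewrite [phi _ * _]mulrC.
have lg : linear (fun t => g (dual_tensor V W t)).
  move=> a x y; rewrite /g scaler_sumr -big_split /=.
  apply: eq_bigr => i _; rewrite scaler_sumr -big_split /=.
  apply: eq_bigr => j _; rewrite linearP add_lfunE scale_lfunE.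
  by rewrite scalerDl scalerA.
apply: (tensor_ext lg) => // xi eta.
have [t1 t2] := tens_bilinear (dual V) (dual W).
rewrite /g [in RHS](dE V xi) (linear_sumE (t1 eta)).
apply: eq_bigr => i _; rewrite [in RHS](dE W eta) (linear_sumE (t2 _)).
rewrite scaler_sumr; apply: eq_bigr => j _.
by rewrite dual_tensor_tens scalerA.
Qed.

End Linear.

Arguments tensor {K} U V.
Arguments dual {K} V.
Arguments dual_tensor {K} V W.

Notation "u ⊗ v" := (tens u v) (at level 37, left associativity) : ring_scope.

(* Products are bilinear, so the product itself, read as an element of
   'Hom(A, 'End(A)), is the left multiplication operator. *)

Record assocAlg (K : fieldType) := AssocAlg {
  assoc_sort :> vectType K;
  amul : 'Hom(assoc_sort, 'End(assoc_sort));
  amulA : forall x y z, amul x (amul y z) = amul (amul x y) z }.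

Record diassocAlg (K : fieldType) := DiassocAlg {
  diassoc_sort :> vectType K;
  dashv : 'Hom(diassoc_sort, 'End(diassoc_sort));
  vdash : 'Hom(diassoc_sort, 'End(diassoc_sort));
  dashvA : forall x y z, dashv (dashv x y) z = dashv x (dashv y z);
  vdashA : forall x y z, vdash (vdash x y) z = vdash x (vdash y z);
  dashv_vdash : forall x y z, dashv (dashv x y) z = dashv x (vdash y z);
  vdash_dashv : forall x y z, dashv (vdash x y) z = vdash x (dashv y z);
  vdash_bar : forall x y z, vdash (dashv x y) z = vdash (vdash x y) z }.

Record quadZinbielAlg (K : fieldType) := QuadZinbielAlg {
  zinbiel_sort :> vectType K;
  zmul : 'Hom(zinbiel_sort, 'End(zinbiel_sort));
  zmulP : forall x y z,
    zmul x (zmul y z) = zmul (zmul x y) z + zmul (zmul y x) z;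
  zform : 'Hom(zinbiel_sort, dual zinbiel_sort);
  zform_skew : forall x y, zform x y = - zform y x;
  zform_nondeg : forall x, (forall y, zform x y = 0) -> x = 0;
  zform_inv : forall x y z,
    zform (zmul x y) z = zform y (zmul x z + zmul z x) }.

Arguments amul {K} a : rename.
Arguments dashv {K} d : rename.
Arguments vdash {K} d : rename.
Arguments zmul {K} z : rename.
Arguments zform {K} z : rename.

Notation "x ⊣ y" := (dashv _ x y) (at level 38, no associativity) : ring_scope.
Notation "x ⊢ y" := (vdash _ x y) (at level 38, no associativity) : ring_scope.
Notation "x ⋄ y" := (zmul _ x y) (at level 38, no associativity) : ring_scope.

Section Assoc.
Variables (K : fieldType) (A : assocAlg K).

Definition lmul_assoc : 'Hom(A, 'End(A)) := amul A.
Definition rmul_assoc : 'Hom(A, 'End(A)) := bilflip (amul A).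

Record assocBimodule := AssocBimodule {
  abimod_sort :> vectType K;
  al : 'Hom(A, 'End(abimod_sort));
  ar : 'Hom(A, 'End(abimod_sort));
  al_mul : forall x y v, al (amul A x y) v = al x (al y v);
  ar_mul : forall x y v, ar (amul A x y) v = ar y (ar x v);
  al_ar : forall x y v, ar y (al x v) = al x (ar y v) }.

Definition assoc_O_operator (V : assocBimodule) (T : 'Hom(V, A)) : Prop :=
  forall v1 v2 : V,
    amul A (T v1) (T v2) = T (al V (T v1) v2 + ar V (T v2) v1).

Lemma coreg_lE a (xi : dual A) v :
  (- dual_rep rmul_assoc) a xi v = xi (amul A v a).
Proof. by rewrite !opp_lfunE dual_repE opprK bilflipE. Qed.

Lemma coreg_rE a (xi : dual A) v :
  (- dual_rep lmul_assoc) a xi v = xi (amul A a v).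
Proof. by rewrite !opp_lfunE dual_repE opprK. Qed.

Program Definition assoc_coregular : assocBimodule :=
  @AssocBimodule (dual A) (- dual_rep rmul_assoc) (- dual_rep lmul_assoc)
    _ _ _.
Next Obligation.
by move=> x y v; apply/lfunP => z; rewrite !coreg_lE amulA.
Qed.
Next Obligation.
by move=> x y v; apply/lfunP => z; rewrite !coreg_rE amulA.
Qed.
Next Obligation.
by move=> x y v; apply/lfunP => z; rewrite coreg_rE !coreg_lE coreg_rE amulA.
Qed.

Definition aybe (s : tensor A A) : tensor (tensor A A) A :=
  tlift2 (fun u v u' v' =>
      amul A u u' ⊗ v ⊗ v' + u ⊗ u' ⊗ amul A v v' - u' ⊗ amul A u v' ⊗ v) s s.

Lemma aybe_sum I (r : seq I) (u v : I -> A) :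
  aybe (\sum_(i <- r) u i ⊗ v i) =
  \sum_(i <- r) \sum_(j <- r)
    (amul A (u i) (u j) ⊗ v i ⊗ v j + u i ⊗ u j ⊗ amul A (v i) (v j)
     - u j ⊗ amul A (u i) (v j) ⊗ v i).
Proof.
rewrite /aybe tlift2_sum //; split=> p q;
  do ?[apply: is_bilinearD | apply: is_bilinearN]; split=> w a x y;
  by rewrite ?linearP /= ?add_lfunE ?scale_lfunE ?tensPl ?tensPr ?tensPl ?tensPr.
Qed.

End Assoc.

Section Diassoc.
Variables (K : fieldType) (D : diassocAlg K).

Definition lmul_dashv : 'Hom(D, 'End(D)) := dashv D.
Definition rmul_dashv : 'Hom(D, 'End(D)) := bilflip (dashv D).
Definition lmul_vdash : 'Hom(D, 'End(D)) := vdash D.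
Definition rmul_vdash : 'Hom(D, 'End(D)) := bilflip (vdash D).

(* The five axioms of a diassociative algebra with the module element in the
   third, second and first place; [dl], [dr] are the left and right actions for
   ⊣ and [vl], [vr] those for ⊢.  Equivalently, the semidirect product of D
   and V is a diassociative algebra. *)
Record diassocBimodule := DiassocBimodule {
  dbimod_sort :> vectType K;
  dl : 'Hom(D, 'End(dbimod_sort));
  dr : 'Hom(D, 'End(dbimod_sort));
  vl : 'Hom(D, 'End(dbimod_sort));
  vr : 'Hom(D, 'End(dbimod_sort));
  dbimod3 : forall x y v,
    [/\ dl (x ⊣ y) v = dl x (dl y v), vl (x ⊢ y) v = vl x (vl y v),
        dl (x ⊣ y) v = dl x (vl y v), dl (x ⊢ y) v = vl x (dl y v)
      & vl (x ⊣ y) v = vl (x ⊢ y) v];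
  dbimod2 : forall x y v,
    [/\ dr y (dl x v) = dl x (dr y v), vr y (vl x v) = vl x (vr y v),
        dr y (dl x v) = dl x (vr y v), dr y (vl x v) = vl x (dr y v)
      & vr y (dl x v) = vr y (vl x v)];
  dbimod1 : forall x y v,
    [/\ dr y (dr x v) = dr (x ⊣ y) v, vr y (vr x v) = vr (x ⊢ y) v,
        dr y (dr x v) = dr (x ⊢ y) v, dr y (vr x v) = vr (x ⊣ y) v
      & vr y (dr x v) = vr y (vr x v)] }.

Definition diassoc_O_operator (V : diassocBimodule) (T : 'Hom(V, D)) : Prop :=
  forall v1 v2 : V,
    T v1 ⊣ T v2 = T (dl V (T v1) v2 + dr V (T v2) v1) /\
    T v1 ⊢ T v2 = T (vl V (T v1) v2 + vr V (T v2) v1).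

Let cdl := dual_rep rmul_vdash - dual_rep rmul_dashv.
Let cdr := - dual_rep lmul_vdash.
Let cvl := - dual_rep rmul_dashv.
Let cvr := dual_rep lmul_dashv - dual_rep lmul_vdash.

Lemma coreg_dlE a (xi : dual D) v : cdl a xi v = xi (v ⊣ a) - xi (v ⊢ a).
Proof.
rewrite /cdl !(add_lfunE, opp_lfunE) !dual_repE.
by rewrite opprK !bilflipE addrC.
Qed.
Lemma coreg_drE a (xi : dual D) v : cdr a xi v = xi (a ⊢ v).
Proof. by rewrite !opp_lfunE dual_repE opprK. Qed.
Lemma coreg_vlE a (xi : dual D) v : cvl a xi v = xi (v ⊣ a).
Proof. by rewrite !opp_lfunE dual_repE opprK bilflipE. Qed.
Lemma coreg_vrE a (xi : dual D) v : cvr a xi v = xi (a ⊢ v) - xi (a ⊣ v).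
Proof.
rewrite /cvr !(add_lfunE, opp_lfunE) !dual_repE.
by rewrite opprK addrC.
Qed.
Let coregE := (coreg_dlE, coreg_drE, coreg_vlE, coreg_vrE).

Program Definition diassoc_coregular : diassocBimodule :=
  @DiassocBimodule (dual D)
    (dual_rep rmul_vdash - dual_rep rmul_dashv)
    (- dual_rep lmul_vdash)
    (- dual_rep rmul_dashv)
    (dual_rep lmul_dashv - dual_rep lmul_vdash) _ _ _.
Next Obligation.
rewrite -/cdl -/cdr -/cvl -/cvr => x y v.
by split; apply/lfunP => z; rewrite !coregE;
  rewrite ?(dashvA, vdashA, vdash_dashv, vdash_bar) -?dashv_vdash ?dashvA
    ?subrr ?subr0 ?opprB ?addrA ?addrK ?addrNK.
Qed.
Next Obligation.
rewrite -/cdl -/cdr -/cvl -/cvr => x y v.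
split; apply/lfunP => z; rewrite !coregE;
  rewrite ?(dashvA, vdashA, vdash_dashv, vdash_bar) -?dashv_vdash ?dashvA
    ?subrr ?subr0 ?opprB ?addrA ?addrK ?addrNK //.
Qed.
Next Obligation.
rewrite -/cdl -/cdr -/cvl -/cvr => x y v.
split; apply/lfunP => z; rewrite !coregE;
  rewrite ?(dashvA, vdashA, vdash_dashv, vdash_bar) -?dashv_vdash ?dashvA
    ?subrr ?subr0 ?opprB ?addrA ?addrK ?addrNK //.
Qed.

Definition dybe (r : tensor D D) : tensor (tensor D D) D :=
  tlift2 (fun x y x' y' =>
      x ⊗ x' ⊗ (y ⊢ y') - x' ⊗ (x ⊣ y') ⊗ y
      - (x ⊢ x') ⊗ y ⊗ y' + (x ⊣ x') ⊗ y ⊗ y') r r.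

Lemma dybe_sum I (r : seq I) (x y : I -> D) :
  dybe (\sum_(i <- r) x i ⊗ y i) =
  \sum_(i <- r) \sum_(j <- r)
    (x i ⊗ x j ⊗ (y i ⊢ y j) - x j ⊗ (x i ⊣ y j) ⊗ y i
     - (x i ⊢ x j) ⊗ y i ⊗ y j + (x i ⊣ x j) ⊗ y i ⊗ y j).
Proof.
rewrite /dybe tlift2_sum //; split=> p q;
  do ?[apply: is_bilinearD | apply: is_bilinearN]; split=> w a z t;
  by rewrite ?linearP /= ?add_lfunE ?scale_lfunE ?tensPl ?tensPr ?tensPl ?tensPr.
Qed.

End Diassoc.

Section Induced.
Variables (K : fieldType) (D : diassocAlg K) (B : quadZinbielAlg K).

Definition induced_mul : 'Hom(tensor D B, 'End(tensor D B)) :=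
  bilfun (tlift2 (fun d1 b1 d2 b2 =>
    (d1 ⊢ d2) ⊗ (b1 ⋄ b2) + (d1 ⊣ d2) ⊗ (b2 ⋄ b1))).

Lemma induced_mul_tens (d1 d2 : D) (b1 b2 : B) :
  induced_mul (d1 ⊗ b1) (d2 ⊗ b2) =
  (d1 ⊢ d2) ⊗ (b1 ⋄ b2) + (d1 ⊣ d2) ⊗ (b2 ⋄ b1).
Proof.
rewrite /induced_mul bilfunE; last exact: tlift2_bilinear.
rewrite tlift2_tens //; split=> p q; apply: is_bilinearD; split=> w a z t;
  by rewrite ?linearP /= ?add_lfunE ?scale_lfunE ?tensPl ?tensPr.
Qed.

Lemma induced_mulA x y z :
  induced_mul x (induced_mul y z) = induced_mul (induced_mul x y) z.
Proof.
move: x; apply: tensor_ext => [a x1 x2|a x1 x2|d1 b1].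
- by rewrite linearP add_lfunE scale_lfunE.
- by rewrite !linearP !add_lfunE !scale_lfunE linearP add_lfunE scale_lfunE.
move: y; apply: tensor_ext => [a x1 x2|a x1 x2|d2 b2].
- by rewrite !linearP !add_lfunE !scale_lfunE linearP.
- by rewrite !linearP !add_lfunE !scale_lfunE.
move: z; apply: tensor_ext => [a x1 x2|a x1 x2|d3 b3].
- by rewrite !linearP.
- by rewrite linearP.
rewrite !induced_mul_tens !linearD /= !add_lfunE !induced_mul_tens.
rewrite vdash_bar !vdashA vdash_dashv -!dashvA !dashv_vdash.
rewrite [LHS]addrACA [RHS]addrACA -!tensDr -zmulP -!addrA; congr (_ + (_ + _)).
  by rewrite !zmulP addrC.
  by rewrite !zmulP addrC.
by rewrite !zmulP addrC.
Qed.

Definition induced_assoc : assocAlg K := AssocAlg induced_mulA.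

End Induced.

(* Main.v *)
(* Evaluate everything on functionals.  Put R := r^#, S := (r~)^#, and

     V(a,b,c) = c(Ra ⊢ Rb),   A(a,b,c) = c(Ra ⊣ Rb),   P(a,b,c) = c(Sa . Sb).

   As r is symmetric, R is self-adjoint and the diassociative Yang-Baxter
   equation reads V(a,b,c) - A(c,a,b) - V(b,c,a) + A(b,c,a) = 0, which is the
   O-operator identity for ⊢ paired with c; adding its rotation
   (a,b,c) -> (c,a,b) gives the identity for ⊣.  For skew-symmetric r~ the
   associative Yang-Baxter equation says that the cyclic sum of P vanishes,
   and this is also the O-operator identity of S.

   The map kappa^# is inverse to b |-> zform b.  The form t(a,b,c) =
   zform (a ⋄ b) c is symmetric in a and c, and its cyclic sum is zero.  On
   pure tensors the cyclic sum of P is thus a combination of the three values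
   of t, with coefficients V(a,b,c) + A(b,c,a) and its rotations; these are
   equal by the equation for r. *)
Require Import Defs.
From mathcomp Require Import all_boot all_order all_algebra.
From mathcomp Require Import ring.
Set Implicit Arguments.
Unset Strict Implicit.
Unset Printing Implicit Defensive.
Import GRing.Theory.
Local Open Scope ring_scope.

(** * Testing tensors against pure functionals *)

Section Pairing.
Variable K : fieldType.
Implicit Types A U V W : vectType K.

Lemma tensor_eq0 U V (t : tensor U V) :
  (forall a b, dual_tensor U V (a ⊗ b) t = 0) -> t = 0.
Proof.
move=> t0; apply/matrixP => i j; rewrite mxE.
(* The i-th and j-th coordinate functionals isolate the single entry [t i j]. *)
have := t0 (linfun (fun u => vcoord u i : K^o))
           (linfun (fun v => vcoord v j : K^o)).
rewrite dual_tensorE /tlift (bigD1 i) //= (bigD1 j) //=.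
rewrite !(linfun_linE (vcoord_linear _)) !vcoord_vbase !eqxx mulr1.
rewrite !big1 ?addr0 => [|k ki|k kj].
- by rewrite -[_ *: _]/(_ * _) mulr1.
- rewrite big1 // => l _; rewrite !(linfun_linE (vcoord_linear _)).
  by rewrite !vcoord_vbase (negbTE ki) mul0r scaler0.
rewrite !(linfun_linE (vcoord_linear _)).
by rewrite !vcoord_vbase (negbTE kj) mulr0 scaler0.
Qed.

(** [dual_tensor] is surjective, so pure tensors of functionals span the dual of [tensor V W]. *)
Lemma dual_tensor_ext V W (F : dual (tensor V W) -> K^o) : linear F ->
  (forall a b, F (dual_tensor V W (a ⊗ b)) = 0) -> forall a, F a = 0.
Proof.
move=> lF F0 a; have [g _ gK] := dual_tensor_bij V W; rewrite -(gK a).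
apply: (@tensor_ext _ _ _ _ (F \o dual_tensor V W) (fun=> 0)) => //=.
- by move=> c x y /=; rewrite linearP lF.
- by move=> c x y; rewrite scaler0 addr0.
Qed.

(** Allows [dybe_sum] and [aybe_sum] to be applied to an arbitrary tensor; the coordinates are
    absorbed into the first factors. *)
Lemma tensor_decomp U V (t : tensor U V) :
  exists (I : Type) (r : seq I) (u : I -> U) (v : I -> V),
    t = \sum_(i <- r) u i ⊗ v i.
Proof.
pose I := ('I_(\dim {:U}) * 'I_(\dim {:V}))%type.
exists I, (index_enum I), (fun p => t p.1 p.2 *: vbase p.1).
exists (fun p => vbase p.2).
rewrite [LHS]tensor_sum pair_big; apply: eq_bigr => p _; apply/matrixP => k l.
by rewrite !mxE /vcoord linearZ /= mulrA.
Qed.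

Lemma sharp_sum A I (r : seq I) (u v : I -> A) xi :
  sharp (\sum_(i <- r) u i ⊗ v i) xi = \sum_(i <- r) (xi (u i) : K) *: v i.
Proof. by rewrite [in LHS]big_tnth [RHS]big_tnth; exact: sharp_tens. Qed.

Lemma tswap_sum U V I (r : seq I) (u : I -> U) (v : I -> V) :
  tswap (\sum_(i <- r) u i ⊗ v i) = \sum_(i <- r) v i ⊗ u i.
Proof.
rewrite /tswap (linear_sum1E (@tlift_linear _ _ _ _ _)).
by apply: eq_bigr => i _; exact: tswap_tens.
Qed.

Lemma sharpN A (s : tensor A A) : sharp (- s) = - sharp s.
Proof.
apply/lfunP => a; rewrite opp_lfunE /sharp !(linfun_linE (sharp_linear _)) /tlift.
rewrite -sumrN; apply: eq_bigr => i _; rewrite -sumrN; apply: eq_bigr => j _.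
by rewrite mxE scaleNr.
Qed.

Lemma dual_sep A (x y : A) : (forall c : dual A, c x = c y) -> x = y.
Proof.
move=> xy; rewrite (vbase_sum x) (vbase_sum y); apply: eq_bigr => i _.
have := xy (linfun (fun u => vcoord u i : K^o)).
by rewrite !(linfun_linE (vcoord_linear _)) => ->.
Qed.

Lemma sharp_tswap A (s : tensor A A) (a b : dual A) :
  a (sharp (tswap s) b) = b (sharp s a).
Proof.
have [I [r [u [v ->]]]] := tensor_decomp s; rewrite tswap_sum !sharp_sum.
rewrite !linear_sum; apply: eq_bigr => i _; rewrite !linearZ.
exact: mulrC.
Qed.

Lemma tswap_eqN A (s : tensor A A) :
  (forall a b : dual A, a (sharp s b) = - b (sharp s a)) -> tswap s = - s.
Proof.
move=> skew; apply/eqP; rewrite -addr_eq0; apply/eqP/tensor_eq0 => a b.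
by rewrite linearD /= -!sharpP sharp_tswap skew addNr.
Qed.

(** The pairing of [a ⊗ b] with [x i ⊗ z j] factors, so the double sum splits. This is the source of
    r~^# = r^# ⊗ kappa^#. *)
Lemma sharp_tens_tens U V (I J : finType) (x y : I -> U) (z w : J -> V)
    (a : dual U) (b : dual V) :
  sharp (\sum_i \sum_j (x i ⊗ z j) ⊗ (y i ⊗ w j)) (dual_tensor U V (a ⊗ b)) =
  sharp (\sum_i x i ⊗ y i) a ⊗ sharp (\sum_j z j ⊗ w j) b.
Proof.
rewrite pair_big !sharp_sum; have [t1 t2] := tens_bilinear U V.
rewrite (linear_sumE (t1 _)).
under [RHS]eq_bigr do rewrite (linear_sumE (t2 _)) scaler_sumr.
rewrite pair_big; apply: eq_bigr => p _ /=.
by rewrite dual_tensor_tens scalerA.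
Qed.

Definition pair3 A (a b c : dual A) : dual (tensor (tensor A A) A) :=
  dual_tensor _ _ (dual_tensor A A (a ⊗ b) ⊗ c).

Lemma pair3E A (a b c : dual A) u v w :
  pair3 a b c (u ⊗ v ⊗ w) = a u * b v * c w.
Proof. by rewrite /pair3 !dual_tensor_tens. Qed.

Lemma tensor3_eq0 A (t : tensor (tensor A A) A) :
  (forall a b c, pair3 a b c t = 0) -> t = 0.
Proof.
move=> t0; apply: tensor_eq0 => phi c.
have [t1 t2] := tens_bilinear (dual (tensor A A)) (dual A).
pose F phi := dual_tensor _ _ (phi ⊗ c) t.
apply: (dual_tensor_ext (F := F)) => [k p q|a b]; rewrite /F.
  by rewrite t1 linearP add_lfunE scale_lfunE.
exact: t0.
Qed.

(** The sum is invariant under rotation of a, b, c, so linearity in the first variable suffices: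
    [addrC addrA] brings c, then b, to the front and finally restores the order. *)
Lemma cyclic_sum_ext V W (m : 'Hom(tensor V W, 'End(tensor V W)))
    (S : 'Hom(dual (tensor V W), tensor V W)) :
  (forall a1 a2 b1 b2 c1 c2,
    let a := dual_tensor V W (a1 ⊗ a2) in
    let b := dual_tensor V W (b1 ⊗ b2) in
    let c := dual_tensor V W (c1 ⊗ c2) in
    a (m (S b) (S c)) + b (m (S c) (S a)) + c (m (S a) (S b)) = 0) ->
  forall a b c : dual (tensor V W),
    a (m (S b) (S c)) + b (m (S c) (S a)) + c (m (S a) (S b)) = 0.
Proof.
move=> cyc0 a b c.
have lin (q w : dual (tensor V W)) : linear (fun p : dual (tensor V W) =>
    p (m (S q) (S w)) + q (m (S w) (S p)) + w (m (S p) (S q))).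
  have SP k p p' : S (k *: p + p') = k *: S p + S p' by exact: linearP.
  have mP k u v : m (k *: u + v) = k *: m u + m v by exact: linearP.
  move=> k p p'; rewrite !SP !mP !(add_lfunE, scale_lfunE) !linearP /=.
  by rewrite !scalerDr [RHS]addrACA; congr (_ + _); rewrite addrACA.
move: a; apply: (dual_tensor_ext (lin b c)) => a1 a2; rewrite addrC addrA.
move: c; apply: (dual_tensor_ext (lin _ b)) => c1 c2; rewrite addrC addrA.
move: b; apply: (dual_tensor_ext (lin _ _)) => b1 b2; rewrite addrC addrA.
exact: cyc0.
Qed.

Lemma mul_sums A (m : 'Hom(A, 'End(A))) (c : dual A)
    I (r : seq I) (al be : I -> K) (y z : I -> A) :
  c (m (\sum_(i <- r) al i *: y i) (\sum_(j <- r) be j *: z j)) =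
  \sum_(i <- r) \sum_(j <- r) al i * be j * c (m (y i) (z j)).
Proof.
rewrite [m _]linear_sum sum_lfunE linear_sum; apply: eq_bigr => i _.
rewrite !linear_sum; apply: eq_bigr => j _.
rewrite !linearZ /= scale_lfunE linearZ /=.
rewrite -[LHS]/(be j * (al i * c (m (y i) (z j)))) mulrCA.
exact: mulrA.
Qed.

(** * Contracting the terms of the Yang-Baxter equations *)

Section Slots.
Variables (A : vectType K) (m : 'Hom(A, 'End(A))).
Variables (I : Type) (r : seq I) (u v : I -> A).
Let s := \sum_(i <- r) u i ⊗ v i.

(** The functionals off the product slot contract one leg of each copy of [s]: contracting [u] gives
    [sharp s], contracting [v] gives [sharp (tswap s)]. *)
Lemma pair3_slot1 a b c :
  pair3 a b c (\sum_(i <- r) \sum_(j <- r) m (u i) (u j) ⊗ v i ⊗ v j) =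
  a (m (sharp (tswap s) b) (sharp (tswap s) c)).
Proof.
rewrite /s tswap_sum !sharp_sum mul_sums linear_sum; apply: eq_bigr => i _.
rewrite linear_sum; apply: eq_bigr => j _ /=.
by rewrite pair3E -mulrA mulrC.
Qed.

Lemma pair3_slot2 a b c :
  pair3 a b c (\sum_(i <- r) \sum_(j <- r) u j ⊗ m (u i) (v j) ⊗ v i) =
  b (m (sharp (tswap s) c) (sharp s a)).
Proof.
rewrite /s tswap_sum !sharp_sum mul_sums linear_sum; apply: eq_bigr => i _.
rewrite linear_sum; apply: eq_bigr => j _ /=.
by rewrite pair3E mulrC mulrA.
Qed.

Lemma pair3_slot3 a b c :
  pair3 a b c (\sum_(i <- r) \sum_(j <- r) u i ⊗ u j ⊗ m (v i) (v j)) =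
  c (m (sharp s a) (sharp s b)).
Proof.
rewrite /s !sharp_sum mul_sums linear_sum; apply: eq_bigr => i _.
rewrite linear_sum; apply: eq_bigr => j _ /=.
by rewrite pair3E.
Qed.

End Slots.

End Pairing.

(** * The diassociative Yang-Baxter equation and O-operators *)

Section DiassocYB.
Variables (K : fieldType) (D : diassocAlg K).

Lemma pair3_dybe (r : tensor D D) (a b c : dual D) : tswap r = r ->
  pair3 a b c (dybe r) =
    c (sharp r a ⊢ sharp r b) - b (sharp r c ⊣ sharp r a)
    - a (sharp r b ⊢ sharp r c) + a (sharp r b ⊣ sharp r c).
Proof.
have [I [q [u [v ->]]]] := tensor_decomp r => sym.
rewrite dybe_sum.
under eq_bigr do rewrite !big_split !sumrN /=.
rewrite !big_split !sumrN /=.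
rewrite !(linearD, linearN) /=.
by rewrite !pair3_slot1 pair3_slot2 pair3_slot3 !sym.
Qed.

Lemma dybe_O_operator (r : tensor D D) : tswap r = r -> dybe r = 0 ->
  @diassoc_O_operator K D (diassoc_coregular D) (sharp r).
Proof.
move=> sym r0 a b.
have adj (p q : dual D) : p (sharp r q) = q (sharp r p).
  by rewrite -{1}sym sharp_tswap.
have E p q w := congr1 (pair3 p q w) r0.
(* Self-adjointness moves [sharp r] onto c, so the coregular actions are evaluated at [sharp r c]
   and become products in D. *)
split; apply: dual_sep => c; rewrite [RHS]adj add_lfunE.
  rewrite [X in X + _]coreg_dlE [X in _ + X]coreg_drE.
  have := E a b c; have := E c a b.
  rewrite !(pair3_dybe _ _ _ sym) !linear0 => E1 E2.
  by apply/eqP; rewrite -subr_eq0 -[0 in X in _ == X]addr0 -{1}E1 -E2;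
    apply/eqP; ring.
rewrite [X in X + _]coreg_vlE [X in _ + X]coreg_vrE.
have := E a b c; rewrite (pair3_dybe _ _ _ sym) linear0 => E1.
by apply/eqP; rewrite -subr_eq0 -E1 !opprD opprK !addrA.
Qed.

End DiassocYB.

(** * The associative Yang-Baxter equation and O-operators *)

Section AssocYB.
Variables (K : fieldType) (A : assocAlg K).

(** Slot 1 contains [tswap s] twice, so its signs cancel; slot 2 contains it once, which offsets the
    minus sign in the equation. *)
Lemma pair3_aybe (s : tensor A A) (a b c : dual A) : tswap s = - s ->
  pair3 a b c (aybe s) =
    a (amul A (sharp s b) (sharp s c)) + b (amul A (sharp s c) (sharp s a))
    + c (amul A (sharp s a) (sharp s b)).
Proof.
have [I [q [u [v ->]]]] := tensor_decomp s => skew.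
rewrite aybe_sum; under eq_bigr do rewrite !big_split sumrN /=.
rewrite !big_split sumrN /=.
rewrite !(linearD, linearN) /=.
rewrite pair3_slot1 pair3_slot2 pair3_slot3 !skew !sharpN !opp_lfunE.
rewrite !linearN /= !opp_lfunE !linearN /= !opprK.
by rewrite addrAC.
Qed.

Lemma aybe_O_operator (s : tensor A A) : tswap s = - s -> aybe s = 0 ->
  @assoc_O_operator K A (assoc_coregular A) (sharp s).
Proof.
move=> skew s0 a b.
have adj (p q : dual A) : p (sharp s q) = - q (sharp s p).
  by rewrite -[s in LHS]opprK -skew sharpN opp_lfunE linearN /= sharp_tswap.
apply: dual_sep => c; rewrite [RHS]adj add_lfunE.
rewrite [X in - (X + _)]coreg_lE [X in - (_ + X)]coreg_rE.
have := congr1 (pair3 a b c) s0; rewrite (pair3_aybe _ _ _ skew) linear0.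
by move/eqP; rewrite addrC addr_eq0 => /eqP ->; rewrite addrC.
Qed.

End AssocYB.

(** * The induced associative algebra *)

Section Induced.
Variables (K : fieldType) (D : diassocAlg K) (B : quadZinbielAlg K).

(** Invariance rewrites the left side with a ⋄ c + c ⋄ a, symmetric in a and c. *)
Lemma zform_outer (a b c : B) : zform B (a ⋄ b) c = zform B (c ⋄ b) a.
Proof. by rewrite !zform_inv addrC. Qed.

(** By [zform_outer] the last two terms add up to the form at a ⋄ c + c ⋄ a and b; invariance and
    skew-symmetry make this minus the first term. *)
Lemma zform_cyclic (a b c : B) :
  zform B (a ⋄ b) c + zform B (b ⋄ c) a + zform B (c ⋄ a) b = 0.
Proof.
rewrite [zform B (b ⋄ c) a]zform_outer zform_inv zform_skew.
rewrite linearD /= add_lfunE.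
by rewrite -addrA addNr.
Qed.

Local Notation A := (induced_assoc D B).

Variables (n : nat) (e f : n.-tuple B) (e_basis : basis_of fullv e).
Hypothesis f_dual :
  forall i j : 'I_n, zform B (tnth f i) (tnth e j) = (i == j)%:R.
Variables (m : nat) (x y : 'I_m -> D).
Let kappa : tensor B B := \sum_j tnth e j ⊗ tnth f j.
Let r : tensor D D := \sum_i x i ⊗ y i.
Let rt : tensor A A := \sum_i \sum_j (x i ⊗ tnth e j) ⊗ (y i ⊗ tnth f j).

(** Since [sharp kappa xi] is the sum of the xi(e_i) f_i, duality of the bases gives both sides the
    value xi(e_j) at e_j. *)
Lemma sharp_kappaK (xi : dual B) : zform B (sharp kappa xi) = xi.
Proof.
apply/lfunP => b; rewrite /kappa sharp_sum (coord_basis e_basis (memvf b)).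
rewrite !linear_sum; apply: eq_bigr => j _; rewrite !linearZ; congr (_ *: _).
rewrite -tnth_nth /= sum_lfunE (bigD1 j) //= big1 => [|i ij].
  by rewrite linearZ scale_lfunE f_dual eqxx addr0 [LHS]mulr1.
by rewrite linearZ scale_lfunE f_dual (negbTE ij) [LHS]mulr0.
Qed.

Lemma sharp_kappa_skew (xi eta : dual B) :
  xi (sharp kappa eta) = - eta (sharp kappa xi).
Proof.
by rewrite -{1}[xi]sharp_kappaK -{2}[eta]sharp_kappaK zform_skew.
Qed.

Lemma sharp_rt (a : dual D) (b : dual B) :
  sharp rt (dual_tensor D B (a ⊗ b)) = sharp r a ⊗ sharp kappa b.
Proof. exact: sharp_tens_tens. Qed.

(** On pure functionals, the symmetry of [r] combines with the skew-symmetry of [kappa]. *)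
Lemma rt_skew : tswap r = r -> tswap rt = - rt.
Proof.
move=> sym; apply: tswap_eqN => a b; apply/eqP; rewrite -addr_eq0; apply/eqP.
move: a; apply: (@dual_tensor_ext _ D B) => [k p q|a1 a2].
  by rewrite add_lfunE scale_lfunE !linearP /= scalerDr addrACA.
move: b; apply: (@dual_tensor_ext _ D B) => [k p q|b1 b2].
  by rewrite add_lfunE scale_lfunE !linearP /= scalerDr addrACA.
rewrite !sharp_rt !dual_tensor_tens -{1}sym sharp_tswap.
by rewrite (sharp_kappa_skew a2) mulrN addNr.
Qed.

Lemma rt_cyclic : tswap r = r -> dybe r = 0 -> forall a b c : dual A,
  a (amul A (sharp rt b) (sharp rt c)) + b (amul A (sharp rt c) (sharp rt a))
  + c (amul A (sharp rt a) (sharp rt b)) = 0.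
Proof.
move=> sym r0 a b c.
move: a b c; apply: cyclic_sum_ext => a1 a2 b1 b2 c1 c2 /=.
rewrite !sharp_rt !induced_mul_tens !linearD /= !dual_tensor_tens.
have E p q w : pair3 p q w (dybe r) = 0 by rewrite r0 linear0.
have E1 := E a1 b1 c1; have E2 := E b1 c1 a1.
rewrite !(pair3_dybe _ _ _ sym) in E1 E2.
(* Writing u as [zform B (sharp kappa u)] turns each Zinbiel factor into a value of the trilinear
   form. *)
have zE (u v w : dual B) :
    u (sharp kappa v ⋄ sharp kappa w) =
    - zform B (sharp kappa v ⋄ sharp kappa w) (sharp kappa u).
  by rewrite -{1}[u]sharp_kappaK zform_skew.
rewrite !zE.
set al := sharp kappa a2; set be := sharp kappa b2; set ga := sharp kappa c2.
have M := zform_cyclic al be ga.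
rewrite (zform_outer ga be) (zform_outer al ga) (zform_outer be al).
move: E1 E2 M; set v3 := c1 (_ ⊢ _); set d3 := c1 (_ ⊣ _).
set v2 := b1 (_ ⊢ _); set d2 := b1 (_ ⊣ _).
set v1 := a1 (_ ⊢ _); set d1 := a1 (_ ⊣ _).
set zb := zform B (al ⋄ be) ga; set zg := zform B (be ⋄ ga) al.
set za := zform B (ga ⋄ al) be => E1 E2 M.
(* The coefficients of [za], [zb], [zg] are -(v2 + d3), -(v3 + d1), -(v1 + d2). [E2] and [E1]
   identify the first two with the third, leaving a multiple of the sum in [M]. *)
transitivity (za * (v1 - d3 - v2 + d2) - zb * (v3 - d2 - v1 + d1)
              - (v1 + d2) * (zb + zg + za)); first by ring.
by rewrite E1 E2 M !mulr0 !subr0.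
Qed.

Lemma rt_aybe : tswap r = r -> dybe r = 0 -> aybe rt = 0.
Proof.
move=> sym r0; apply: tensor3_eq0 => a b c.
by rewrite (pair3_aybe _ _ _ (rt_skew sym)) rt_cyclic.
Qed.

Lemma sharp_rt_dual_tensor :
  (sharp rt \o dual_tensor D B)%VF = tensor_hom (sharp r) (sharp kappa).
Proof.
apply/lfunP; apply: (tensor_ext (linearP _) (linearP _)) => a b /=.
by rewrite comp_lfunE tensor_homE sharp_rt.
Qed.

End Induced.

Theorem proposition3p13 (K : fieldType) (charK : [pchar K] =i pred0)
    (D : diassocAlg K) (B : quadZinbielAlg K)
    (n : nat) (e f : n.-tuple B) (e_basis : basis_of fullv e)
    (f_dual : forall i j : 'I_n, zform B (tnth f i) (tnth e j) = (i == j)%:R)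
    (m : nat) (x y : 'I_m -> D) :
  let kappa : tensor B B := \sum_j tnth e j ⊗ tnth f j in
  let r : tensor D D := \sum_i x i ⊗ y i in
  let rt : tensor (induced_assoc D B) (induced_assoc D B) :=
    \sum_i \sum_j (x i ⊗ tnth e j) ⊗ (y i ⊗ tnth f j) in
  tswap r = r -> dybe r = 0 ->
  [/\ @diassoc_O_operator K D (diassoc_coregular D) (sharp r),
      tswap rt = - rt,
      aybe rt = 0,
      (sharp rt \o dual_tensor D B)%VF = tensor_hom (sharp r) (sharp kappa)
    & @assoc_O_operator K (induced_assoc D B)
        (assoc_coregular (induced_assoc D B)) (sharp rt)].
Proof.
move=> kappa r rt sym r0.
have skew : tswap rt = - rt by exact: (rt_skew e_basis f_dual sym).
have rt0 : aybe rt = 0 by exact: (rt_aybe e_basis f_dual sym r0).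
split=> //.
- exact: dybe_O_operator.
- exact: sharp_rt_dual_tensor.
- exact: aybe_O_operator.
Qed.
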